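(* Let $R$ be a (Noetherian) regular ring, not necessarily local, and let $\mathfrak m$ be a maximal ideal of $R$ such that $\dim R_{\mathfrak m}=d\geq 2$. Then $\mathrm{Fitt}_{d-1}(\mathfrak m)=\mathfrak m$.
   Context: A Noetherian ring is regular if all its localizations at prime ideals are regular local rings. For a finitely generated module $M$ over a Noetherian ring $R$, choose a finite free presentation $G\to F\to M\to 0$ with $\mathrm{rank}\,F=r$, and let $A$ be a matrix representing $G\to F$. The $j$th Fitting ideal of $M$ is $\mathrm{Fitt}_j(M)=I_{r-j}(A)$, where $I_t(A)$ is the ideal generated by the $t$-minors of $A$, with $I_t(A)=R$ for $t\le 0$. This is independent of the choices. The ideal $\mathfrak m$ is regarded as an $R$-module. *)

(* Defs.v *)
From HB Require Import structures.
From mathcomp Require Import all_boot all_algebra.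
From mathcomp Require Import generic_quotient ring_quotient.
From mathcomp Require Import ring boolp classical_sets.

Set Implicit Arguments.
Unset Strict Implicit.
Unset Printing Implicit Defensive.

Import GRing.Theory.
Local Open Scope ring_scope.
Local Open Scope classical_set_scope.

(* [idealr R] and [prime_idealr R] are MathComp's boolean-valued proper (resp.
   prime) ideals.  With the classical axioms of boolp every Prop-valued subset
   is the extension of a boolean predicate, so quantifying over these types is
   quantifying over all proper (resp. prime) ideals.  Ideals which may be the
   whole ring are represented as [set R]. *)

Section Ideals.
Variable R : comNzRingType.

Definition ideal_gen (S : set R) : set R :=
  [set x | exists (n : nat) (a s : 'I_n -> R),
     (forall i, S (s i)) /\ x = \sum_(i < n) a i * s i].

Definition generated_by_n (n : nat) (I : idealr R) : Prop :=
  exists s : n.-tuple R, ideal_gen [set` s] = [set` I].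

Definition min_number_of_generators (I : idealr R) (n : nat) : Prop :=
  generated_by_n n I /\ forall k, generated_by_n k I -> (n <= k)%N.

(* The unit ideal, excluded from [idealr R], is generated by 1. *)
Definition noetherian : Prop :=
  forall I : idealr R, exists n, generated_by_n n I.

Definition maximal_ideal (m : idealr R) : Prop :=
  forall I : idealr R, {subset m <= I} -> I =i m.

Definition prime_chain (n : nat) : Prop :=
  exists p : 'I_n.+1 -> prime_idealr R,
    forall i j : 'I_n.+1, (i < j)%N -> [set` p i] `<` [set` p j].

Definition krull_dim (d : nat) : Prop :=
  prime_chain d /\ forall n, prime_chain n -> (n <= d)%N.

Definition regular_local : Prop :=
  noetherian /\
  exists n : idealr R,
    [/\ maximal_ideal n,
        forall n' : idealr R, maximal_ideal n' -> n' =i n &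
        exists d, krull_dim d /\ min_number_of_generators n d].

Section MaximalPrime.
Variables (m : idealr R) (hm : maximal_ideal m).

Lemma maximal_prime_closed : prime_idealr_closed m.
Proof.
move=> u v uvm; apply/orP; case: (boolP (u \in m)) => um; [by left | right].
pose J : {pred R} := fun x =>
  `[< exists a, exists2 y, y \in m & x = a * u + y >].
have inJ x : reflect (exists a, exists2 y, y \in m & x = a * u + y) (x \in J).
  exact: asboolP.
have mJ : {subset m <= J}.
  by move=> x xm; apply/inJ; exists 0, x => //; rewrite mul0r add0r.
have [|J1] := boolP (1 \in J).
  case/inJ=> a [y ym e]; rewrite -[v]mul1r e mulrDl rpredD //.
    by rewrite -mulrA idealMr.
  by rewrite mulrC idealMr.
have cJ : idealr_closed J.
  split=> //; first by apply/mJ/idealr0.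
  move=> a x y /inJ[b [z zm ->]] /inJ[c [w wm ->]]; apply/inJ.
  exists (a * b + c), (a * z + w); first by rewrite rpredD ?idealMr.
  by rewrite mulrDr mulrDl !mulrA addrACA.
pose I : idealr R := HB.pack (J : R -> bool) (isIdealr.Build R J cJ).
have uI : u \in I by apply/inJ; exists 1, 0; rewrite ?idealr0 ?mul1r ?addr0.
by move: um; rewrite -(hm (I := I) mJ) uI.
Qed.

Definition maximal_to_prime : prime_idealr R :=
  HB.pack (m : R -> bool) m
    (isPrimeIdealrClosed.Build R (m : R -> bool) maximal_prime_closed).

End MaximalPrime.

End Ideals.


(* [localization p] is R_p, the quotient of R * (R \ p) by
   (a, s) ~ (b, t) iff u * (a * t) = u * (b * s) for some u outside p. *)
Module Localization.
Section Localization.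
Variables (R : comNzRingType) (p : prime_idealr R).
Local Open Scope quotient_scope.

Record den := Den { dval : R; denP : dval \notin p }.
HB.instance Definition _ := [isSub for dval].
HB.instance Definition _ := [Choice of den by <:].

Lemma den1_subproof : (1 : R) \notin p. Proof. by rewrite idealr1. Qed.
Definition den1 : den := Den den1_subproof.

Lemma denM_subproof (s t : den) : dval s * dval t \notin p.
Proof. by rewrite prime_idealrM negb_or !denP. Qed.
Definition denM (s t : den) : den := Den (denM_subproof s t).

Definition ratio := (R * den)%type.
HB.instance Definition _ := Choice.on ratio.
Implicit Types x y z : ratio.

Definition equivl x y : bool :=
  `[< exists u : den, dval u * (x.1 * dval y.2) = dval u * (y.1 * dval x.2) >].

Lemma equivlP x y : reflect
  (exists u : den, dval u * (x.1 * dval y.2) = dval u * (y.1 * dval x.2))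
  (equivl x y).
Proof. exact: asboolP. Qed.

Lemma equivl_refl : reflexive equivl.
Proof. by move=> x; apply/equivlP; exists den1. Qed.

Lemma equivl_sym : symmetric equivl.
Proof. by move=> x y; apply/equivlP/equivlP => -[u e]; exists u. Qed.

Lemma equivl_trans : transitive equivl.
Proof.
move=> y x z /equivlP[t e] /equivlP[u f].
apply/equivlP; exists (denM (denM t u) y.2).
transitivity (dval t * (x.1 * dval y.2) * (dval u * dval z.2)).
  by rewrite /=; ring.
rewrite e; transitivity (dval u * (y.1 * dval z.2) * (dval t * dval x.2)).
  by ring.
by rewrite f /=; ring.
Qed.

Canonical equivl_equiv := EquivRel equivl equivl_refl equivl_sym equivl_trans.

Definition type := {eq_quot equivl}.
HB.instance Definition _ : EqQuotient _ equivl type := EqQuotient.on type.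
HB.instance Definition _ := Choice.on type.

Lemma equivl_repr x : equivl (repr (\pi_type x)) x.
Proof. by apply/eqmodP; rewrite reprK. Qed.

Definition addl x y : ratio :=
  (x.1 * dval y.2 + y.1 * dval x.2, denM x.2 y.2).
Definition oppl x : ratio := (- x.1, x.2).
Definition mull x y : ratio := (x.1 * y.1, denM x.2 y.2).

Definition zero : type := \pi_type ((0, den1) : ratio).
Definition one : type := \pi_type ((1, den1) : ratio).
Definition add := lift_op2 type addl.
Definition opp := lift_op1 type oppl.
Definition mul := lift_op2 type mull.

Lemma pi_add : {morph \pi_type : x y / addl x y >-> add x y}.
Proof.
move=> x y; unlock add; apply/esym/eqmodP/equivlP.
have /equivlP[t e] := equivl_repr x; have /equivlP[u f] := equivl_repr y.
set x' := repr _ in e *; set y' := repr _ in f *.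
exists (denM t u); rewrite /addl /=.
transitivity (dval t * (x'.1 * dval x.2) * (dval u * (dval y'.2 * dval y.2)) +
              dval u * (y'.1 * dval y.2) * (dval t * (dval x'.2 * dval x.2))).
  by ring.
by rewrite e f; ring.
Qed.
Canonical pi_add_morph := PiMorph2 pi_add.

Lemma pi_opp : {morph \pi_type : x / oppl x >-> opp x}.
Proof.
move=> x; unlock opp; apply/esym/eqmodP/equivlP.
have /equivlP[t e] := equivl_repr x; set x' := repr _ in e *.
by exists t; rewrite /oppl /= !mulNr !mulrN e.
Qed.
Canonical pi_opp_morph := PiMorph1 pi_opp.

Lemma pi_mul : {morph \pi_type : x y / mull x y >-> mul x y}.
Proof.
move=> x y; unlock mul; apply/esym/eqmodP/equivlP.
have /equivlP[t e] := equivl_repr x; have /equivlP[u f] := equivl_repr y.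
set x' := repr _ in e *; set y' := repr _ in f *.
exists (denM t u); rewrite /mull /=.
transitivity (dval t * (x'.1 * dval x.2) * (dval u * (y'.1 * dval y.2))).
  by ring.
by rewrite e f; ring.
Qed.
Canonical pi_mul_morph := PiMorph2 pi_mul.

Lemma addA : associative add.
Proof.
elim/quotW=> x; elim/quotW=> y; elim/quotW=> z; rewrite -!pi_add.
by apply/eqmodP/equivlP; exists den1; rewrite /addl /=; ring.
Qed.

Lemma addC : commutative add.
Proof.
elim/quotW=> x; elim/quotW=> y; rewrite -!pi_add.
by apply/eqmodP/equivlP; exists den1; rewrite /addl /=; ring.
Qed.

Lemma add0 : left_id zero add.
Proof.
elim/quotW=> x; rewrite /zero -!pi_add.
by apply/eqmodP/equivlP; exists den1; rewrite /addl /=; ring.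
Qed.

Lemma addN : left_inverse zero opp add.
Proof.
elim/quotW=> x; rewrite /zero -pi_opp -pi_add.
by apply/eqmodP/equivlP; exists den1; rewrite /addl /oppl /=; ring.
Qed.

HB.instance Definition _ := GRing.isZmodule.Build type addA addC add0 addN.

Lemma mulA : associative mul.
Proof.
elim/quotW=> x; elim/quotW=> y; elim/quotW=> z; rewrite -!pi_mul.
by apply/eqmodP/equivlP; exists den1; rewrite /mull /=; ring.
Qed.

Lemma mulC : commutative mul.
Proof.
elim/quotW=> x; elim/quotW=> y; rewrite -!pi_mul.
by apply/eqmodP/equivlP; exists den1; rewrite /mull /=; ring.
Qed.

Lemma mul1 : left_id one mul.
Proof.
elim/quotW=> x; rewrite /one -!pi_mul.
by apply/eqmodP/equivlP; exists den1; rewrite /mull /=; ring.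
Qed.

Lemma mulDl : left_distributive mul add.
Proof.
elim/quotW=> x; elim/quotW=> y; elim/quotW=> z.
rewrite -pi_add -!pi_mul -pi_add.
by apply/eqmodP/equivlP; exists den1; rewrite /mull /addl /=; ring.
Qed.

Lemma one_neq0 : one != 0.
Proof.
apply/eqP => /eqmodP/equivlP[t /=]; rewrite !mulr1 mulr0 => t0.
by have := denP t; rewrite t0 idealr0.
Qed.

HB.instance Definition _ :=
  GRing.Zmodule_isComNzRing.Build type mulA mulC mul1 mulDl one_neq0.

End Localization.
End Localization.
HB.export Localization.

Definition localization (R : comNzRingType) (p : prime_idealr R) :
  comNzRingType := Localization.type p.

Definition regular_ring (R : comNzRingType) : Prop :=
  noetherian R /\
  forall p : prime_idealr R, regular_local (localization p).

(* An ideal regarded as an R-module: a submodule of the regular module R^o. *)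
Section IdealModule.
Variables (R : comNzRingType) (I : idealr R).

Definition ideal_pred : {pred R^o} := [pred x : R | x \in I].

Lemma ideal_pred_submod : submod_closed ideal_pred.
Proof.
by split=> [|a x y xI yI]; rewrite inE ?idealr0 // rpredD ?idealMr.
Qed.
HB.instance Definition _ :=
  GRing.isSubmodClosed.Build R R^o ideal_pred ideal_pred_submod.

Definition ideal_module := {x : R^o | x \in ideal_pred}.
HB.instance Definition _ := [isSub of ideal_module for @sval _ _].
HB.instance Definition _ := [Choice of ideal_module by <:].
HB.instance Definition _ := [SubChoice_isSubLmodule of ideal_module by <:].

End IdealModule.

Section Fitting.
Variable R : comNzRingType.

(* A finite free presentation G -> F -> M -> 0 with G = R^s, F = R^r.
   Matrices act on row vectors on the right, so pres_mx is the s x r matrix of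
   G -> F; its minors do not depend on this convention. *)
Record presentation (M : lmodType R) := Presentation {
  rel_rank : nat;
  gen_rank : nat;
  pres_mx : 'M[R]_(rel_rank, gen_rank);
  pres_map : {linear 'rV[R]_gen_rank -> M};
  pres_surj : forall y : M, exists v, pres_map v = y;
  pres_exact : forall v,
    pres_map v = 0 <-> exists u : 'rV[R]_rel_rank, v = u *m pres_mx
}.

(* The only 0-minor is the empty determinant 1, so minor_ideal 0 A = R. *)
Definition minor_ideal (s r t : nat) (A : 'M[R]_(s, r)) : set R :=
  ideal_gen [set x | exists (f : 'I_t -> 'I_s) (g : 'I_t -> 'I_r),
    [/\ {homo f : i j / (i < j)%N}, {homo g : i j / (i < j)%N} &
        x = \det (mxsub f g A)]].

(* I_(r-j)(A) for a chosen finite free presentation of M; the truncated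
   subtraction gives I_0 = R when j >= r.  The result is the empty set if M is
   not finitely presented. *)
Definition Fitt (j : nat) (M : lmodType R) : set R :=
  get [set I | exists P : presentation M,
         I = minor_ideal (gen_rank P - j) (pres_mx P)].

End Fitting.

(* Main.v *)
From HB Require Import structures.
Require Import Defs.
From mathcomp Require Import all_boot all_algebra all_fingroup.
From mathcomp Require Import ring_quotient generic_quotient.
From mathcomp Require Import ring zify boolp classical_sets.

Set Implicit Arguments.
Unset Strict Implicit.
Unset Printing Implicit Defensive.

Local Open Scope classical_set_scope.

Import GRing.Theory.

(** The ideal is computed from an arbitrary finite free presentation of [m],
    with relation matrix [A] and generators [x_1, ..., x_r].  Regularity enters
    through the Noetherian condition, which provides a presentation, and through
    the fact that the maximal ideal of the local ring at [m] is minimally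
    generated by [d] elements ([regular_local_generators]).

    Let [t] be the largest size of a minor [D] of [A] lying outside [m].  After
    inverting [D], the [t] relations involved solve for the [t] generators in
    the columns of [D] ([minor_eliminates]), so the [r - t] other generators
    suffice near [m].  A relation [c] among those others only yields the
    bordered minor [D * c_q] of size [t + 1] ([bordered_minor]), which lies in
    [m]; hence all such relations have coefficients in [m], the remaining
    generators are minimal at [m], and [r - t = d] ([complement_card]).  Thus
    Fitt_(d-1) is generated by the minors of size [t + 1], and it is contained
    in [m] by the choice of [t].

    For the converse, the trivial relations [x_p x_q - x_q x_p = 0] are used.
    As [d >= 2], every remaining generator [x_p] has a partner [x_q], and
    bordering [D] by their trivial relation puts [D x_p], hence [D ^ 2 m], into
    the ideal ([minor_idealE]).  This settles the matter at [m].  Away from [m]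
    the trivial relations involving a fixed [x_i] have the minor [x_i ^ (t + 1)]
    ([generator_power_minor]), so the ideal contains a power of every element
    of [m].  An equation [1 = a D ^ 2 + b] with [b] in [m] glues the two. *)

(** * Ideals as subsets *)

Section Ideals.
Local Open Scope ring_scope.

Definition is_ideal {R : comNzRingType} (J : set R) : Prop :=
  [/\ J 0, forall x y, J x -> J y -> J (x + y) & forall a x, J x -> J (a * x)].

Variable R : comNzRingType.
Implicit Types (S J : set R).

Lemma is_ideal_sum J (I : Type) (r : seq I) (P : pred I) (F : I -> R) :
  is_ideal J -> (forall i, P i -> J (F i)) -> J (\sum_(i <- r | P i) F i).
Proof. by case=> J0 JD _ JF; elim/big_ind: _. Qed.

Lemma is_ideal_idealr (I : idealr R) : is_ideal [set` I].
Proof.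
split=> [|x y /= xI yI|a x /= xI]; rewrite /= ?idealr0 ?rpredD ?idealMr //.
Qed.

Lemma ideal_gen_mem S : S `<=` ideal_gen S.
Proof.
move=> x Sx; exists 1%N, (fun=> 1), (fun=> x).
by rewrite big_ord1 mul1r.
Qed.

Lemma ideal_gen_sub S J : is_ideal J -> S `<=` J -> ideal_gen S `<=` J.
Proof.
move=> Jid SJ _ [n [a [s [Ss ->]]]]; apply: is_ideal_sum => // i _.
by case: Jid => _ _; apply; apply: SJ.
Qed.

Lemma ideal_gen_ideal S : is_ideal (ideal_gen S).
Proof.
split.
- by exists 0%N, (fun=> 0), (fun=> 0); split; [case | rewrite big_ord0].
- move=> _ _ [n [a [s [Ss ->]]]] [k [b [u [Su ->]]]].
  exists (n + k)%N.
  exists (fun i => match split i with inl j => a j | inr j => b j end).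
  exists (fun i => match split i with inl j => s j | inr j => u j end).
  split=> [i|]; first by case: (split i).
  rewrite big_split_ord /=; congr (_ + _); apply: eq_bigr => i _.
    by rewrite (unsplitK (inl i)).
  by rewrite (unsplitK (inr i)).
- move=> c _ [n [a [s [Ss ->]]]]; exists n, (fun i => c * a i), s; split=> //.
  by rewrite mulr_sumr; apply: eq_bigr => i _; rewrite mulrA.
Qed.

Lemma maximal_ideal_comaximal (m : idealr R) (u : R) :
  maximal_ideal m -> u \notin m -> exists a, exists2 b, b \in m & 1 = a * u + b.
Proof.
move=> mmax um; apply: contrapT => no1.
pose J (z : R) := `[< exists a, exists2 b, b \in m & z = a * u + b >].
have Jid : idealr_closed J.
  split=> [||a y z /asboolP[b [c cm ->]] /asboolP[b' [c' c'm ->]]].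
  - by apply/asboolP; exists 0, 0; rewrite ?idealr0 ?mul0r ?addr0.
  - by apply/negP=> /asboolP.
  - apply/asboolP; exists (a * b + b'), (a * c + c').
      by rewrite rpredD ?idealMr.
    by rewrite mulrDr mulrDl !mulrA addrACA.
pose I : idealr R := HB.pack J (isIdealr.Build R J Jid).
have /mmax mI : {subset m <= I}.
  by move=> z zm; apply/asboolP; exists 0, z; rewrite ?mul0r ?add0r.
move/negP: um; apply; rewrite -mI; apply/asboolP.
by exists 1, 0; rewrite ?idealr0 ?mul1r ?addr0.
Qed.

(** Each term of the binomial expansion has [y] to a power at least [k], or else
    [x] to a power at least [n]. *)
Lemma ideal_radicalD J x y n k :
  is_ideal J -> J (x ^+ n) -> J (y ^+ k) -> J ((x + y) ^+ (n + k)).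
Proof.
move=> Jid Jx Jy; have [_ _ JM] := Jid.
rewrite exprDn; apply: is_ideal_sum => // i _.
rewrite -mulr_natl; apply: (JM).
case: (leqP k i) => [ki|ik].
  by rewrite -[X in y ^+ X](subnK ki) exprD mulrA; apply: (JM).
have -> : (n + k - i = (k - i) + n)%N.
  by rewrite addnBAC ?(ltnW ik) // [(k + n)%N]addnC.
by rewrite exprD mulrAC; apply: (JM).
Qed.

Lemma ideal_radical_sum J (I : finType) (F : I -> R) :
  is_ideal J -> (forall i, exists n, J (F i ^+ n)) ->
  exists n, J ((\sum_i F i) ^+ n).
Proof.
move=> Jid JF; elim/big_ind: _ => [|x y [n xn] [k yk]|i _]; last exact: JF.
  by exists 1%N; case: Jid.
by exists (n + k)%N; apply: ideal_radicalD.
Qed.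

End Ideals.

(** * Minors of arbitrary row and column selections *)

Section Minors.
Local Open Scope ring_scope.
Variable R : comNzRingType.

Lemma enum_val_homo n (E : {set 'I_n}) :
  {homo @enum_val _ (mem E) : i j / (i < j)%N}.
Proof.
move=> i j ij; rewrite /enum_val.
have srt : sorted ltn [seq val x | x <- enum E].
  rewrite /enum_mem sorted_map; apply: sorted_filter.
    by move=> y x z; apply: ltn_trans.
  by rewrite -sorted_map -enumT val_enum_ord iota_ltn_sorted.
have x0 := enum_default i.
rewrite !(set_nth_default x0) -?cardE //.
rewrite -[X in (X < _)%N](nth_map x0 0%N val) -?cardE //.
rewrite -[X in (_ < X)%N](nth_map x0 0%N val) -?cardE //.
apply: (sorted_ltn_nth ltn_trans) => //; rewrite inE size_map -cardE //.
Qed.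

(** Minors are indexed by increasing selections; this reduces an injective
    selection to an increasing one at the price of a permutation, that is, of
    a sign in the determinant. *)
Lemma injective_sort t n (f : 'I_t -> 'I_n) : injective f ->
  exists (f' : 'I_t -> 'I_n) (s : 'S_t),
    {homo f' : i j / (i < j)%N} /\ f =1 f' \o s.
Proof.
move=> injf; pose E := [set f i | i : 'I_t]%SET.
have cE : #|E| = t by rewrite card_imset ?card_ord.
have fE i : f i \in E by apply: imset_f.
pose s0 i := cast_ord cE (enum_rank_in (fE i) (f i)).
have s0K i : enum_val (cast_ord (esym cE) (s0 i)) = f i.
  by rewrite /s0 cast_ordK enum_rankK_in.
have injs0 : injective s0.
  by move=> i j eij; apply: injf; rewrite -(s0K i) eij s0K.
exists (fun i => enum_val (cast_ord (esym cE) i)), (perm injs0); split.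
  by move=> i j ij; apply: enum_val_homo.
by move=> i /=; rewrite permE s0K.
Qed.

Lemma det_rowsub_eq0 t n (A : 'M[R]_(n, t)) (f : 'I_t -> 'I_n) :
  ~ injective f -> \det (rowsub f A) = 0.
Proof.
move=> ninj; have /existsNP[i /existsNP[j /not_implyP[fij nij]]] := ninj.
apply: (@determinant_alternate _ _ _ i j); first exact/eqP.
by move=> k; rewrite !mxE fij.
Qed.

(** A non-injective selection gives a determinant with two equal rows or
    columns, and sorting an injective one changes at most the sign, so
    monotonicity of the selections never has to be checked. *)
Lemma minor_idealP s r t (A : 'M[R]_(s, r)) (f : 'I_t -> 'I_s)
    (g : 'I_t -> 'I_r) : minor_ideal t A (\det (mxsub f g A)).
Proof.
have [I0 _ IM] : is_ideal (minor_ideal t A) := ideal_gen_ideal _.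
have [/injective_sort[f' [sg [f'mono f'E]]]|ninjf] :=
  EM (injective f); last first.
  by rewrite mxsubrc det_rowsub_eq0.
have [/injective_sort[g' [tu [g'mono g'E]]]|ninjg] :=
  EM (injective g); last first.
  by rewrite mxsubcr -det_tr trmx_mxsub det_rowsub_eq0.
have -> : mxsub f g A = row_perm sg (col_perm tu (mxsub f' g' A)).
  by apply/matrixP=> i j; rewrite !mxE f'E g'E.
rewrite row_permE col_permE !det_mulmx !det_perm; apply: (IM); rewrite mulrC.
by apply: (IM); apply: ideal_gen_mem; exists f', g'.
Qed.

(** The multilinear expansion of the determinant along all rows, which is the
    Cauchy-Binet formula before equal selections are collected. *)
Lemma det_mulmx_rowsub t s (C : 'M[R]_(t, s)) (A : 'M[R]_(s, t)) :
  \det (C *m A) =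
  \sum_(h : {ffun 'I_t -> 'I_s}) (\prod_i C i (h i)) * \det (rowsub h A).
Proof.
rewrite /determinant.
under [RHS]eq_bigr => h _ do rewrite mulr_sumr.
rewrite [RHS]exchange_big /=; apply: eq_bigr => p _.
under [in LHS]eq_bigr => i _ do rewrite mxE.
rewrite bigA_distr_bigA mulr_sumr; apply: eq_bigr => h _ /=.
rewrite big_split /= mulrCA; congr (_ * (_ * _)).
by apply: eq_bigr => i _; rewrite mxE.
Qed.

(** In the expansion every selection repeats a row, by the pigeonhole
    principle.  This replaces a rank count over the residue field. *)
Lemma det_mulmx_thin k d (C : 'M[R]_(k, d)) (A : 'M[R]_(d, k)) :
  (d < k)%N -> \det (C *m A) = 0.
Proof.
move=> dk; rewrite det_mulmx_rowsub big1 // => h _.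
rewrite det_rowsub_eq0 ?mulr0 // => /leq_card.
by rewrite !card_ord leqNgt dk.
Qed.

(** Any tuple of relations, not only rows of the presentation matrix, may be
    used to produce elements of the Fitting ideal. *)
Lemma minor_row_combinations s r t (A : 'M[R]_(s, r)) (W : 'M[R]_(t, r))
    (g : 'I_t -> 'I_r) : (forall i, exists u, row i W = u *m A) ->
  minor_ideal t A (\det (colsub g W)).
Proof.
move=> /choice[u uE].
have -> : W = (\matrix_i u i) *m A.
  by apply/row_matrixP => i; rewrite uE row_mul rowK.
have -> : colsub g ((\matrix_i u i) *m A) = (\matrix_i u i) *m colsub g A.
  by apply/matrixP=> i j; rewrite !mxE; apply: eq_bigr => k _; rewrite !mxE.
rewrite det_mulmx_rowsub; apply: is_ideal_sum => [|h _].
  exact: ideal_gen_ideal.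
have [_ _ IM] : is_ideal (minor_ideal t A) := ideal_gen_ideal _.
by apply: (IM); rewrite -mxsubrc; apply: minor_idealP.
Qed.

Local Open Scope quotient_scope.

(** The determinant commutes with reduction modulo [m]. *)
Lemma det_diag_mod (m : idealr R) n (M : 'M[R]_n) (D : 'rV[R]_n) :
  (forall i j, (M - diag_mx D) i j \in m) -> \det M - \prod_i D 0 i \in m.
Proof.
move=> Mm; rewrite Quotient.idealrBE.
rewrite -[X in _ == \pi X]det_diag -!det_map_mx; apply/eqP; congr (\det _).
apply/matrixP => i j; rewrite !mxE; apply/eqP; rewrite -Quotient.idealrBE.
by have := Mm i j; rewrite !mxE.
Qed.

End Minors.

(** The entries of [y] generate the extension of [m] to the localization at
    [m], with denominators cleared.  The denominator may depend on [x]. *)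
Definition locally_generates {R : comNzRingType} (m : idealr R) k
    (y : 'cV[R]_k) : Prop :=
  (forall i, y i 0%R \in m) /\
  forall x, x \in m -> exists2 D, D \notin m &
    exists c : 'rV_k, (D * x = (c *m y) 0 0)%R.

(** * Minors of a relation matrix *)

Section Relations.
Local Open Scope ring_scope.
Variables (R : comNzRingType) (s r : nat) (A : 'M[R]_(s, r)) (x : 'cV[R]_r).
Hypothesis relP : forall v : 'rV_r, v *m x = 0 <-> exists u, v = u *m A.

Lemma relations_mulmx0 : A *m x = 0.
Proof.
apply/row_matrixP=> i; rewrite row_mul row0; apply/relP.
by exists (delta_mx 0 i); rewrite -rowE.
Qed.

(** Cramer's rule: multiplying the rows [f] of [A] by the adjugate of the minor
    gives relations whose block on the columns [g] is scalar, and these clear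
    the columns [g] of [D *: v]. *)
Lemma minor_eliminates t (f : 'I_t -> 'I_s) (g : 'I_t -> 'I_r) (v : 'rV_r) :
  exists2 c : 'rV_r, forall k, c 0 (g k) = 0 &
    c *m x = \det (mxsub f g A) *: (v *m x).
Proof.
set B := mxsub f g A; pose V := \adj B *m rowsub f A.
exists (\det B *: v - colsub g v *m V) => [k|].
  have VgE : colsub g V = (\det B)%:M.
    rewrite -mul_adj_mx /V /B.
    by apply/matrixP=> i j; rewrite !mxE; apply: eq_bigr => l _; rewrite !mxE.
  have -> : (\det B *: v - colsub g v *m V) 0 (g k) =
            (\det B *: colsub g v - colsub g v *m colsub g V) 0 k.
    by rewrite !mxE; congr (_ - _); apply: eq_bigr => l _; rewrite !mxE.
  by rewrite VgE mul_mx_scalar subrr mxE.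
rewrite mulmxBl -scalemxAl -!mulmxA.
have -> : rowsub f A *m x = 0.
  rewrite -[RHS](mxsub_const f id) -[const_mx 0]/(0 : 'M_(s, 1)).
  by rewrite -relations_mulmx0 mul_rowsub_mx.
by rewrite !mulmx0 subr0.
Qed.

(** Bordering the rows [f] of [A] by the relation [c] and the columns [g] by [q]
    gives a block triangular matrix. *)
Lemma bordered_minor t (f : 'I_t -> 'I_s) (g : 'I_t -> 'I_r) (c : 'rV_r) q :
  c *m x = 0 -> (forall k, c 0 (g k) = 0) ->
  minor_ideal (t + 1) A (\det (mxsub f g A) * c 0 q).
Proof.
move=> cx0 cg0; pose W := col_mx (rowsub f A) c.
pose h (k : 'I_(t + 1)) := match split k with inl i => g i | inr _ => q end.
have -> : \det (mxsub f g A) * c 0 q = \det (colsub h W).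
  have -> : c 0 q = \det ((c 0 q)%:M : 'M_1) by rewrite det_scalar expr1.
  rewrite -(det_ublock _ (mxsub f (fun=> q) A)); congr (\det _).
  apply/matrixP=> i j; rewrite [RHS]mxE /W /h.
  case: (split_ordP i) => i' ->; case: (split_ordP j) => j' ->.
  - by rewrite block_mxEul col_mxEu !mxE.
  - by rewrite block_mxEur col_mxEu !mxE.
  - by rewrite block_mxEdl col_mxEd mxE ord1 cg0.
  - by rewrite block_mxEdr col_mxEd !ord1 mxE.
apply: minor_row_combinations => k; case: (split_ordP k) => i ->.
  exists (delta_mx 0 (f i)); rewrite -rowE.
  by apply/rowP=> j; rewrite mxE col_mxEu !mxE.
apply/relP; rewrite -cx0; congr (_ *m _).
by apply/rowP=> j; rewrite !ord1 mxE col_mxEd.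
Qed.

Lemma koszul_relation p q :
  (x p 0 *: delta_mx 0 q - x q 0 *: delta_mx 0 p : 'rV_r) *m x = 0.
Proof.
apply/matrixP=> i j; rewrite !ord1 mulmxBl -!scalemxAl -!rowE !mxE.
by rewrite mulrC subrr.
Qed.

(** On [t] columns other than [i], the trivial relations between [x_i] and the
    corresponding generators form the scalar matrix [x_i]. *)
Lemma generator_power_minor t i :
  (t < r)%N -> minor_ideal t A (x i 0 ^+ t).
Proof.
move=> tr.
have tC : (t <= #|[set~ i]%SET|)%N.
  by rewrite cardsC1 card_ord -ltnS (ltn_predK tr).
pose g k : 'I_r := enum_val (widen_ord tC k).
have gi k : g k != i by have := enum_valP (widen_ord tC k); rewrite !inE.
pose W := \matrix_(k < t)
  (x i 0 *: delta_mx 0 (g k) - x (g k) 0 *: delta_mx 0 i : 'rV_r).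
have -> : x i 0 ^+ t = \det (colsub g W).
  rewrite -det_scalar; congr (\det _); apply/matrixP => k l.
  rewrite !mxE eqxx /= (negPf (gi l)) mulr0 subr0.
  rewrite (inj_eq enum_val_inj) -val_eqE /= val_eqE eq_sym.
  by rewrite mulr_natr.
apply: minor_row_combinations => k; apply/relP.
by rewrite rowK koszul_relation.
Qed.

(** * The Fitting ideal at the maximal ideal *)

Section AtMaximalIdeal.
Variables (m : idealr R) (d : nat).
Hypothesis mmax : maximal_ideal m.
Hypothesis xP : forall y, y \in m <-> exists v : 'rV_r, y = (v *m x) 0 0.
Hypothesis gen_d : exists y : 'cV[R]_d, locally_generates m y.
Hypothesis min_d : forall k (y : 'cV[R]_k), locally_generates m y -> (d <= k)%N.
Hypothesis d_ge2 : (2 <= d)%N.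

Let mprime u v : u \notin m -> v \notin m -> u * v \notin m.
Proof.
by move=> um vm; apply/negP=> /(maximal_prime_closed mmax)/orP[]; apply/negP.
Qed.

Let x_in_m i : x i 0 \in m.
Proof. by apply/xP; exists (delta_mx 0 i); rewrite -rowE mxE. Qed.

Lemma largest_minor : exists t (f : 'I_t -> 'I_s) (g : 'I_t -> 'I_r),
  [/\ injective g, \det (mxsub f g A) \notin m &
      minor_ideal (t + 1) A `<=` [set` m]].
Proof.
pose Q t := `[< exists (f : 'I_t -> 'I_s) (g : 'I_t -> 'I_r),
  \det (mxsub f g A) \notin m >].
have Qinj t f g : \det (mxsub f g A : 'M_t) \notin m -> injective g.
  move=> Dm; apply: contrapT => ninj; move/negP: Dm; apply.
  by rewrite mxsubcr -det_tr trmx_mxsub det_rowsub_eq0 ?idealr0.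
have Q0 : Q 0%N.
  have ord_elim n : 'I_0 -> 'I_n by case.
  by apply/asboolP; exists (ord_elim s), (ord_elim r); rewrite det_mx00 idealr1.
have Qle t : Q t -> (t <= r)%N.
  move=> /asboolP[f [g /Qinj/leq_card]]; by rewrite !card_ord.
have [t /asboolP[f [g Dm]] tmax] := ex_maxnP (ex_intro _ 0%N Q0) Qle.
exists t, f, g; split=> //; first exact: Qinj Dm.
apply: ideal_gen_sub; first exact: is_ideal_idealr.
move=> _ [f' [g' [_ _ ->]]]; apply: contrapT => /negP D'm.
have /tmax : Q (t + 1)%N by apply/asboolP; exists f', g'.
by rewrite addn1 ltnn.
Qed.

Section LargestMinor.
Variables (t : nat) (f : 'I_t -> 'I_s) (g : 'I_t -> 'I_r).
Let D := \det (mxsub f g A).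
Hypothesis g_inj : injective g.
Hypothesis D_notin : D \notin m.
Hypothesis minor_in_m : minor_ideal (t + 1) A `<=` [set` m].

Let E : {set 'I_r} := (~: [set g k | k : 'I_t])%SET.
Let h : 'I_#|E| -> 'I_r := enum_val.

Let h_im k i : h k != g i.
Proof.
have := enum_valP k; rewrite -/(h k) !inE; apply: contraNneq => ->.
exact: imset_f.
Qed.

Lemma card_complement : (#|E| + t = r)%N.
Proof.
by rewrite -{1}(card_ord t) -(card_imset predT g_inj) addnC cardsC card_ord.
Qed.

(** The set [E] consists of the columns outside the minor [D]; the generators
    [rowsub h x] with index in [E] are the ones that [D] does not eliminate. *)
Lemma eliminated_span (c : 'rV_r) : (forall k, c 0 (g k) = 0) ->
  c *m x = colsub h c *m rowsub h x.
Proof.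
move=> cg0; apply/matrixP=> i j; rewrite !mxE (bigID (mem E)) /=.
rewrite [X in _ + X]big1 ?addr0 => [|k].
  rewrite big_enum_val; apply: eq_bigr => k _; by rewrite !mxE.
by rewrite !inE negbK => /imsetP[l _ ->]; rewrite ord1 cg0 mul0r.
Qed.

Lemma complement_locally_generates : locally_generates m (rowsub h x).
Proof.
split=> [i|y /xP[v ->]]; first by rewrite mxE.
exists D => //; have [c cg0 cE] := minor_eliminates f g v.
exists (colsub h c); rewrite -eliminated_span // cE [in RHS]mxE //.
Qed.

(** If [d < #|E|], express the generators with index in [E] through [d] local
    generators [y], and [y] back through them: up to elements outside [m] this
    writes them as [Z *m Y] times themselves.  The differences are relations,
    whose coefficients lie in [m] as bordered minors of [D] do, so [Z *m Y] is
    invertible diagonal modulo [m] although it factors through rank [d]. *)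
Lemma complement_card : #|E| = d.
Proof.
apply/eqP; rewrite eqn_leq (min_d complement_locally_generates) andbT leqNgt.
apply/negP => dE; have [y [ym genm]] := gen_d.
have /choice[sg sgP] (k : 'I_#|E|) : exists p : R * 'rV_d,
    p.1 \notin m /\ p.1 * x (h k) 0 = (p.2 *m y) 0 0.
  by have [a am [c ac]] := genm _ (x_in_m (h k)); exists (a, c).
(* The columns eliminated by [D] are avoided, which costs a factor [D]. *)
have yE i : exists c : 'rV_r,
    (forall k, c 0 (g k) = 0) /\ c *m x = D *: row i y.
  have /xP[v yv] := ym i; have [c cg0 cE] := minor_eliminates f g v.
  exists c; split=> //; rewrite cE; congr (_ *: _).
  by apply/rowP=> j; rewrite !ord1 -yv mxE.
have [Y0 Y0P] := choice yE.
pose Y := \matrix_i Y0 i; pose Z := \matrix_k (sg k).2.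
have YE : Y *m x = D *: y.
  apply/row_matrixP=> i; rewrite row_mul rowK (proj2 (Y0P i)).
  by apply/rowP=> j; rewrite !mxE.
pose dl := \row_k (D * (sg k).1).
have /det_diag_mod : forall i j, (Z *m colsub h Y - diag_mx dl) i j \in m.
  move=> i j.
  pose c : 'rV_r := row i (Z *m Y) - (D * (sg i).1) *: delta_mx 0 (h i).
  have cx0 : c *m x = 0.
    rewrite /c mulmxBl -row_mul -mulmxA YE -scalemxAl -rowE.
    apply/rowP=> l; rewrite !ord1 -scalemxAr.
    have := (sgP i).2; rewrite !mxE => sgi.
    rewrite -mulrA sgi -mulrBr.
    apply/eqP; rewrite mulrBr subr_eq0; apply/eqP; congr (_ * _).
    by apply: eq_bigr => k _; rewrite !mxE.
  have cg0 k : c 0 (g k) = 0.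
    rewrite !mxE eq_sym (negPf (h_im _ _)) andbF mulr0 subr0 big1 // => l _.
    by rewrite !mxE (proj1 (Y0P l)) mulr0.
  have /minor_in_m/= := bordered_minor f (h j) cx0 cg0.
  have -> : (Z *m colsub h Y - diag_mx dl) i j = c 0 (h j).
    rewrite !mxE; congr (_ - _).
      by apply: eq_bigr => l _; rewrite !mxE.
    by rewrite (inj_eq enum_val_inj) /= eq_sym mulr_natr.
  by apply: contraTT => cm; apply: mprime.
rewrite det_mulmx_thin // sub0r rpredN; apply/negP.
elim/big_ind: _ => [|u v|k _]; rewrite ?idealr1 //; first exact: mprime.
by rewrite mxE mprime // (sgP k).1.
Qed.

(** The set [J] of elements multiplying [m] into the ideal contains [1 - b],
    a multiple of [D ^ 2], and a power [b ^ n] that lies in the ideal itself.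
    As [1 - b ^ n] is a multiple of [1 - b], it contains 1. *)
Lemma minor_idealE : minor_ideal (r - (d - 1)) A = [set` m].
Proof.
have rE : (d + t = r)%N by rewrite -complement_card card_complement.
have -> : (r - (d - 1) = t + 1)%N by lia.
have Iid : is_ideal (minor_ideal (t + 1) A) := ideal_gen_ideal _.
have [I0 ID IM] := Iid.
apply/seteqP; split=> // y ym.
have Dx_in k : minor_ideal (t + 1) A (D * x (h k) 0).
  have [l lk] : exists l, l != k.
    have : (0 < #|[set~ k]%SET|)%N.
      by rewrite cardsC1 card_ord complement_card; lia.
    by case/card_gt0P=> l; rewrite !inE => lk; exists l.
  have := bordered_minor f (h l) (koszul_relation (h k) (h l)).
  rewrite !mxE !eqxx /= (inj_eq enum_val_inj) (negPf lk) mulr0 mulr1 subr0.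
  apply=> i; rewrite !mxE /= ![g i == _]eq_sym !(negPf (h_im _ _)).
  by rewrite !mulr0 subr0.
have D2_in z : z \in m -> minor_ideal (t + 1) A (D ^+ 2 * z).
  move=> /xP[v ->]; have [c cg0 cE] := minor_eliminates f g v.
  have -> : D ^+ 2 * (v *m x) 0 0 = D * (c *m x) 0 0.
    by rewrite cE !mxE mulrA.
  rewrite (eliminated_span cg0) mxE mulr_sumr; apply: is_ideal_sum => // k _.
  by rewrite mulrCA [rowsub _ _ _ _]mxE; apply: (IM).
pose J := [set a | forall z, z \in m -> minor_ideal (t + 1) A (a * z)].
suff J1 : J 1 by rewrite -[y]mul1r; apply: J1.
have [a [b bm abE]] : exists a, exists2 b, b \in m & 1 = a * D ^+ 2 + b.
  by apply: (maximal_ideal_comaximal mmax); rewrite expr2 mprime.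
have [n bn] : exists n, minor_ideal (t + 1) A (b ^+ n).
  have /xP[v ->] := bm; rewrite mxE; apply: ideal_radical_sum => // i.
  exists (t + 1)%N; rewrite exprMn; apply: (IM).
  by apply: generator_power_minor; lia.
have Jb : J (1 - b) by move=> z zm; rewrite abE addrK -mulrA; apply/IM/D2_in.
move=> z zm; rewrite -[1](subrK (b ^+ n)) mulrDl; apply: (ID).
  rewrite -[X in X - _](expr1n _ n) subrXX mulrAC mulrC; apply/IM.
  exact: Jb.
by rewrite mulrC; apply: (IM).
Qed.
End LargestMinor.
End AtMaximalIdeal.
End Relations.

(** * Clearing denominators in the local ring *)

Section LocalGenerators.
Local Open Scope ring_scope.
Local Open Scope quotient_scope.
Variables (R : comNzRingType) (m : idealr R) (mmax : maximal_ideal m).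
Let p := maximal_to_prime mmax.

Definition fraction (a : R) (s : Localization.den p) : localization p :=
  \pi_(Localization.type p) ((a, s) : Localization.ratio p).

Lemma fraction_surj z : exists a s, z = fraction a s.
Proof. by elim/quotW: z => -[a s]; exists a, s. Qed.

Lemma fraction_eqP a b s t : fraction a s = fraction b t <->
  exists u : Localization.den p,
    Localization.dval u * (a * Localization.dval t) =
    Localization.dval u * (b * Localization.dval s).
Proof.
split=> [/eqmodP/Localization.equivlP //|e].
exact/eqmodP/Localization.equivlP.
Qed.

Lemma fractionD a b s t : fraction a s + fraction b t =
  fraction (a * Localization.dval t + b * Localization.dval s)
    (Localization.denM s t).
Proof. exact: (esym (@Localization.pi_add R p (a, s) (b, t))). Qed.

Lemma fractionM a b s t :
  fraction a s * fraction b t = fraction (a * b) (Localization.denM s t).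
Proof. exact: (esym (@Localization.pi_mul R p (a, s) (b, t))). Qed.

Let o := Localization.den1 p.

Lemma fraction1 : fraction 1 o = 1. Proof. by []. Qed.
Lemma fraction0 : fraction 0 o = 0. Proof. by []. Qed.

Lemma fraction_sum k (a b : 'I_k -> R) s :
  fraction (\sum_i a i * b i) s = \sum_i fraction (a i) s * fraction (b i) o.
Proof.
elim/big_ind2: _ => [|x1 x2 y1 y2 <- <-|i _].
- by apply/fraction_eqP; exists o; rewrite !mul0r.
- by rewrite fractionD; apply/fraction_eqP; exists o; rewrite /=; ring.
- by rewrite fractionM; apply/fraction_eqP; exists o; rewrite /=; ring.
Qed.

Lemma fraction_in_m a b s t : fraction a s = fraction b t ->
  (a \in m) = (b \in m).
Proof.
move=> /fraction_eqP[u e].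
have mE c (v w : Localization.den p) :
    (Localization.dval v * (c * Localization.dval w) \in m) = (c \in m).
  apply/idP/idP=> [|cm]; last by rewrite idealMr // mulrC idealMr.
  rewrite -[_ \in m]/(_ \in p) !prime_idealrM => /or3P[vm|//|wm].
    by rewrite (negPf (Localization.denP v)) in vm.
  by rewrite (negPf (Localization.denP w)) in wm.
by rewrite -(mE a u t) e mE.
Qed.

(** The fractions with numerator in [m] form a proper ideal whose complement
    consists of units, hence a maximal one. *)
Lemma local_maximal_idealP (n : idealr (localization p)) :
  (forall n' : idealr (localization p), maximal_ideal n' -> n' =i n) ->
  forall a s, (fraction a s \in n) = (a \in m).
Proof.
move=> nuniq.
pose J (z : localization p) :=
  `[< exists2 a, a \in m & exists s, z = fraction a s >].
have JP a s : (J (fraction a s)) = (a \in m).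
  apply/asboolP/idP => [[b bm [t e]]|am]; last by exists a => //; exists s.
  by rewrite (fraction_in_m e).
have Jid : idealr_closed J.
  split=> [||z x y]; rewrite -?fraction0 -?fraction1 /in_mem /= ?JP.
  - exact: idealr0.
  - by rewrite idealr1.
  have [[a [s ->]] [[b [t ->]] [c [u ->]]]] :=
    (fraction_surj z, (fraction_surj x, fraction_surj y)).
  rewrite fractionM fractionD !JP => bm cm.
  rewrite rpredD //; last by rewrite mulrC idealMr.
  by rewrite mulrC idealMr // idealMr.
pose I : idealr (localization p) :=
  HB.pack (J : _ -> bool) (isIdealr.Build _ J Jid).
have Imax : maximal_ideal I.
  move=> I' JI' z; apply/idP/idP=> [|/JI'//].
  have [a [s ->]] := fraction_surj z => aI'.
  rewrite /in_mem /= JP; apply: contraT => am.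
  have /negP[] : (1 : localization p) \notin I' by rewrite idealr1.
  pose a' : Localization.den p := Localization.Den (am : a \notin p).
  have -> : 1 = fraction (Localization.dval s) a' * fraction a s.
    rewrite fractionM -fraction1; apply/fraction_eqP; exists o => /=; ring.
  exact: idealMr.
by move=> a s; rewrite -(nuniq _ Imax) /in_mem /= JP.
Qed.

(** Regularity at [m] read off in [R]: the embedding dimension is [d].
    Generators of the maximal ideal of the local ring may be replaced by their
    numerators, which differ from them by units, and local generators of [m]
    become generators of that ideal. *)
Lemma regular_local_generators d :
  regular_local (localization p) -> krull_dim (localization p) d ->
  (exists y : 'cV[R]_d, locally_generates m y) /\
  (forall k (y : 'cV[R]_k), locally_generates m y -> (d <= k)%N).
Proof.
move=> [_ [n [_ /local_maximal_idealP nP [d' [[ch' d'max] [[w wn] wmin]]]]]].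
move=> [ch dmax].
have dd : d' = d by apply/eqP; rewrite eqn_leq dmax ?d'max.
subst d'; split=> [|k y [ym ygen]].
  have w_in i : tnth w i \in n.
    suff : [set` n] (tnth w i) by [].
    by rewrite -wn; apply: ideal_gen_mem => /=; apply: mem_tnth.
  have /choice[ys ysE] i : exists q : R * Localization.den p,
      tnth w i = fraction q.1 q.2.
    by have [a [s e]] := fraction_surj (tnth w i); exists (a, s).
  exists (\col_i (ys i).1); split=> [i|x xm].
    by rewrite mxE -(nP _ (ys i).2) -ysE.
  pose K (z : localization p) := exists c : 'rV[R]_d, exists s,
    z = fraction ((c *m \col_i (ys i).1) 0 0) s.
  have Kid : is_ideal K.
    split.
    - exists 0, o; rewrite mul0mx mxE; exact: fraction0.
    - move=> _ _ [c [s ->]] [c' [s' ->]].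
      exists (Localization.dval s' *: c + Localization.dval s *: c').
      exists (Localization.denM s s'); rewrite fractionD.
      by rewrite mulmxDl -!scalemxAl !mxE ![Localization.dval _ * _]mulrC.
    - move=> z _ [c [s ->]]; have [a [t ->]] := fraction_surj z.
      exists (a *: c), (Localization.denM t s).
      by rewrite fractionM -scalemxAl [in RHS]mxE.
  have /(ideal_gen_sub Kid) : [set` w] `<=` K.
    move=> _ /tnthP[i ->]; exists (delta_mx 0 i), (ys i).2.
    by rewrite -rowE !mxE -ysE.
  rewrite wn => /(_ (fraction x o)); rewrite /= nP => /(_ xm)[c [s]].
  move=> /fraction_eqP[u e].
  exists (Localization.dval (Localization.denM u s)).
    exact: Localization.denP.
  exists (Localization.dval u *: c).
  rewrite -scalemxAl [in RHS]mxE /=.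
  by rewrite -mulrA [_ * x]mulrC e mulr1.
apply: wmin; exists [tuple fraction (y i 0) o | i < k].
apply/seteqP; split.
  apply: ideal_gen_sub; first exact: is_ideal_idealr.
  by move=> _ /mapP[i _ ->] /=; rewrite nP.
move=> z /=; have [a [s ->]] := fraction_surj z.
rewrite nP => /ygen[D Dm [c ce]].
pose D' : Localization.den p := Localization.Den (Dm : D \notin p).
exists k, (fun i => fraction (c 0 i) (Localization.denM D' s)).
exists (fun i => fraction (y i 0) o); split=> [i /=|].
  by apply/mapP; exists i; rewrite ?mem_enum.
rewrite -fraction_sum; apply/fraction_eqP; exists o => /=.
by move: ce; rewrite mxE => <-; ring.
Qed.

End LocalGenerators.

(** * Presentations of an ideal *)

Section Presentations.
Local Open Scope ring_scope.
Variables (R : comNzRingType).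

Lemma ideal_gen_tupleP n (w : n.-tuple R) z : ideal_gen [set` w] z ->
  exists c : 'I_n -> R, z = \sum_i c i * tnth w i.
Proof.
pose K z := exists c : 'I_n -> R, z = \sum_i c i * tnth w i.
suff : ideal_gen [set` w] `<=` K by apply.
apply: ideal_gen_sub => [|_ /tnthP[i ->]]; last first.
  exists (fun j => (j == i)%:R); rewrite (bigD1 i) //= eqxx mul1r.
  by rewrite big1 ?addr0 // => j /negPf->; rewrite mul0r.
split=> [|_ _ [a ->] [b ->]|a _ [b ->]].
- by exists (fun=> 0); rewrite big1 // => i _; rewrite mul0r.
- exists (fun i => a i + b i); rewrite -big_split /=.
  by apply: eq_bigr => i _; rewrite mulrDl.
- exists (fun i => a * b i); rewrite mulr_sumr.
  by apply: eq_bigr => i _; rewrite mulrA.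
Qed.

(** The unit ideal is generated by 1; the Noetherian condition speaks of proper
    ideals. *)
Lemma noetherian_generators (J : set R) : noetherian R -> is_ideal J ->
  exists k (w : 'I_k -> R), (forall i, J (w i)) /\
    forall z, J z -> exists c : 'I_k -> R, z = \sum_i c i * w i.
Proof.
move=> noethR [J0 JD JM]; have [J1|J1] := EM (J 1).
  exists 1%N, (fun=> 1); split=> // z _.
  by exists (fun=> z); rewrite big_ord1 mulr1.
pose j z := `[< J z >].
have jid : idealr_closed j.
  split=> [||a y z /asboolP Jy /asboolP Jz]; first exact/asboolP.
    exact/asboolP.
  by apply/asboolP/JD => //; apply: JM.
pose I : idealr R := HB.pack j (isIdealr.Build R j jid).
have [k [w wE]] := noethR I.
have IP z : [set` I] z <-> J z by split=> [/asboolP //|Jz]; apply/asboolP.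
exists k, (tnth w); split=> [i|z /IP].
  by apply/IP; rewrite -wE; apply: ideal_gen_mem => /=; apply: mem_tnth.
by rewrite -wE => /ideal_gen_tupleP.
Qed.

(** Induction on [n]: the first coordinates of [N] form a finitely generated
    ideal, and subtracting a combination of lifts of its generators moves an
    element of [N] into the part of [N] with first coordinate 0. *)
Lemma noetherian_submodule n (N : set 'rV[R]_n) : noetherian R ->
  N 0 -> (forall u v, N u -> N v -> N (u + v)) ->
  (forall a u, N u -> N (a *: u)) ->
  exists k (M : 'M[R]_(k, n)), forall v, N v <-> exists u, v = u *m M.
Proof.
move=> noethR; elim: n N => [|n IHn]; last rewrite -[n.+1]/(1 + n)%N;
  move=> N N0 ND NZ.
  exists 0%N, 0 => v; split=> [_|_]; last by rewrite [v]thinmx0.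
  by exists 0; rewrite !thinmx0.
have Nsum k (V : 'I_k -> 'rV_(1 + n)) (c : 'rV_k) : (forall i, N (V i)) ->
    N (c *m \matrix_i V i).
  move=> NV; rewrite mulmx_sum_row; elim/big_ind: _ => // i _.
  by rewrite rowK; apply: NZ.
have [|||k' [M' M'P]] := IHn (fun v => N (row_mx (0 : 'rV_1) v)).
- by rewrite row_mx0.
- move=> u v Nu Nv; rewrite -[X in row_mx X _]addr0 -add_row_mx; exact: ND.
- move=> a u Nu; rewrite -(scaler0 _ a) -scale_row_mx; exact: NZ.
pose J (a : R) := exists2 v, N v & v 0 ord0 = a.
have Jid : is_ideal J.
  split=> [|_ _ [u Nu <-] [v Nv <-]|a _ [v Nv <-]].
  - by exists 0; rewrite ?mxE.
  - by exists (u + v); rewrite ?mxE //; apply: ND.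
  - by exists (a *: v); rewrite ?mxE //; apply: NZ.
have [k [w [Jw wgen]]] := noetherian_generators noethR Jid.
have /choice[V VP] i : exists v, N v /\ v 0 ord0 = w i.
  by have [v Nv e] := Jw i; exists v.
exists (k + k')%N, (col_mx (\matrix_i V i) (row_mx (0 : 'cV_k') M')) => v.
split=> [Nv|[u ->]]; last first.
  rewrite -[u]hsubmxK mul_row_col mul_mx_row mulmx0; apply: ND.
    by apply: Nsum => i; have [] := VP i.
  by apply/M'P; exists (rsubmx u).
have [|c ce] := wgen (v 0 ord0); first by exists v.
pose c' : 'rV_k := \row_i c i.
pose v' : 'rV_(1 + n) := v - c' *m \matrix_i V i.
have v'0 : lsubmx v' = 0.
  apply/rowP=> j; rewrite !mxE.
  have -> : lshift n j = ord0 by apply: val_inj; rewrite /= ord1.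
  apply/eqP; rewrite ce subr_eq0; apply/eqP/eq_bigr => i _.
  by rewrite !mxE; have [_ ->] := VP i.
have [|u uE] := (M'P (rsubmx v')).1.
  rewrite -v'0 hsubmxK /v'; apply: (ND) => //.
  rewrite -scaleN1r; apply/NZ/Nsum => i; by have [] := VP i.
exists (row_mx c' u); rewrite mul_row_col mul_mx_row mulmx0 -uE -v'0 hsubmxK.
by rewrite /v' addrC subrK.
Qed.

Lemma ideal_presentation (m : idealr R) : noetherian R ->
  inhabited (presentation (ideal_module m)).
Proof.
move=> noethR.
have [k [w [wm wgen]]] := noetherian_generators noethR (is_ideal_idealr m).
pose x : 'cV_k := \col_i w i.
have vx_in (v : 'rV_k) : ((v *m x) 0 0 : R^o) \in ideal_pred m.
  rewrite inE mxE; apply: rpred_sum => i _; apply: idealMr.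
  by rewrite mxE; apply: wm.
pose phi (v : 'rV_k) : ideal_module m :=
  exist (fun y : R^o => y \in ideal_pred m) _ (vx_in v).
have phi_lin : linear phi.
  by move=> a u v; apply: val_inj; rewrite /= mulmxDl -scalemxAl !mxE.
pose phiL : {linear 'rV_k -> ideal_module m} :=
  HB.pack phi (GRing.isLinear.Build R 'rV_k (ideal_module m) _ phi phi_lin).
have [|||k' [A AP]] := noetherian_submodule (N := fun v => phiL v = 0) noethR.
- exact: linear0.
- by move=> u v u0 v0; rewrite linearD u0 v0 addr0.
- by move=> a u u0; rewrite linearZ_LR u0 scaler0.
split; apply: (@Presentation _ _ _ _ A phiL) => // -[y ym].
have [c cE] := wgen _ ym; exists (\row_i c i); apply: val_inj => /=.
by rewrite cE mxE; apply: eq_bigr => i _; rewrite !mxE.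
Qed.

Lemma presentation_generators (m : idealr R)
    (P : presentation (ideal_module m)) :
  exists x : 'cV[R]_(gen_rank P),
  (forall v : 'rV_(gen_rank P),
    v *m x = 0 <-> exists u, v = u *m pres_mx P) /\
  (forall y, y \in m <-> exists v : 'rV_(gen_rank P), y = (v *m x) 0 0).
Proof.
pose phi := pres_map P.
pose x : 'cV[R]_(gen_rank P) := \col_i (val (phi (delta_mx 0 i)) : R).
have phiE v : val (phi v) = (v *m x) 0 0 :> R.
  rewrite [v in LHS]row_sum_delta !linear_sum mxE; apply: eq_bigr => i _.
  by rewrite linearZ mxE.
exists x; split=> [v|y].
  rewrite -pres_exact -/phi; split=> [vx0|phi0].
    by apply: val_inj; rewrite phiE vx0 mxE.
  by apply/rowP=> j; rewrite !ord1 -phiE phi0 mxE.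
split=> [ym|[v ->]]; last by rewrite -phiE; exact: (valP (phi v)).
have [v vE] :=
  pres_surj P (exist (fun y : R^o => y \in ideal_pred m) (y : R^o) ym).
by exists v; rewrite -phiE /phi vE.
Qed.
End Presentations.

(** * The Fitting ideal of a maximal ideal of a regular ring *)

Theorem corollary1p6 (R : comNzRingType) (Rreg : regular_ring R)
  (m : idealr R) (mmax : maximal_ideal m) (d : nat)
  (dim_d : krull_dim (localization (maximal_to_prime mmax)) d)
  (d_ge2 : (2 <= d)%N) :
  Fitt (d - 1) (ideal_module m) = [set` m].
Proof.
have [noethR locR] := Rreg.
have [gen_d min_d] := regular_local_generators (locR _) dim_d.
have minorE (P : presentation (ideal_module m)) :
    minor_ideal (gen_rank P - (d - 1)) (pres_mx P) = [set` m].
  have [x [xrel xgen]] := presentation_generators P.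
  have [t [f [g [g_inj Dm Im]]]] := largest_minor (pres_mx P) m.
  exact: (minor_idealE xrel mmax xgen gen_d min_d d_ge2 g_inj Dm Im).
have [P] := ideal_presentation m noethR.
(* [get] returns the ideal of some presentation as soon as there is one. *)
rewrite /Fitt; set S := [set I | _].
have [Q ->] : S (get S); last exact: minorE.
by apply: getPex; exists (minor_ideal (gen_rank P - (d - 1)) (pres_mx P)), P.
Qed.
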